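(* The problem Fare Zone Assignment (FZA) restricted to rooted instances can be solved (i.e., an optimal cut set $F\subseteq E$ can be computed) in $\mathcal{O}(n^2k)$ time, where $n=|V|$ is the number of vertices of the tree and $k$ the number of commodities.
   Context: Fare Zone Assignment (FZA): given a tree $T=(V,E)$ with $n=|V|$, a non-decreasing concave function $f\colon\mathbb{N}_0\to\mathbb{R}_{\ge 0}$, and commodities $i\in[k]$, each given by a path $P_i\subseteq E$ in $T$, a bound $u_i\in\mathbb{N}_0$ and a weight $w_i\in\mathbb{N}$, find $F\subseteq E$ maximizing $\sum_{i\in[k]}\mathrm{rev}_i(F)$, where $\mathrm{rev}_i(F)=w_i\cdot f(|P_i\cap F|)$ if $|P_i\cap F|\le u_i$ and $\mathrm{rev}_i(F)=0$ otherwise. An instance is rooted if all commodity paths $P_i$ share a common endpoint $r$ (the root). *)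

(* Defs.v *)
From HB Require Import structures.
From mathcomp Require Import all_boot all_order all_algebra.
From mathcomp Require Import reals.

Set Implicit Arguments.
Unset Strict Implicit.
Unset Printing Implicit Defensive.

Import Order.TTheory GRing.Theory Num.Theory.

Local Open Scope ring_scope.

(* Vertices are 'I_nv and edges are 'I_ne; [ends e] lists the two ends of the
   undirected edge e in an arbitrary order. *)
Record fza (R : realType) := Fza {
  nv : nat;
  ne : nat;
  nk : nat;
  ends : 'I_ne -> 'I_nv * 'I_nv;
  fare : nat -> R;
  pth : 'I_nk -> {set 'I_ne};
  bnd : 'I_nk -> nat;
  wgt : 'I_nk -> nat
}.

Section FareZoneAssignment.
Variables (R : realType) (I : fza R).

Definition joins (e : 'I_(ne I)) (x y : 'I_(nv I)) : bool :=
  (ends e == (x, y)) || (ends e == (y, x)).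

Definition adj : rel 'I_(nv I) := [rel x y | [exists e, joins e x y]].

Definition simple_graph : Prop :=
  (forall e, (@ends _ I e).1 != (ends e).2) /\
  (forall e e' x y, joins e x y -> joins e' x y -> e = e').

(* A list [:: x; y] traversing one edge back and forth is a [ucycle] of [adj],
   hence the bound 2. *)
Definition acyclic : Prop :=
  forall c : seq 'I_(nv I), ucycle adj c -> (size c <= 2)%N.

Definition is_tree : Prop :=
  [/\ (0 < nv I)%N, simple_graph, (forall x y, connect adj x y) & acyclic].

Definition path_edges (x : 'I_(nv I)) (p : seq 'I_(nv I)) : {set 'I_(ne I)} :=
  [set e | has (fun xy => joins e xy.1 xy.2) (zip (x :: p) p)].

(* Trivial paths (x = y, A = set0) are allowed. *)
Definition is_path (A : {set 'I_(ne I)}) (x y : 'I_(nv I)) : Prop :=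
  exists p, [/\ path adj x p, uniq (x :: p), last x p = y & A = path_edges x p].

Definition is_fare : Prop :=
  [/\ (forall j, 0 <= fare I j),
      (forall j j', (j <= j')%N -> fare I j <= fare I j') &
      (forall j, fare I j.+2 - fare I j.+1 <= fare I j.+1 - fare I j)].

Definition fza_wf : Prop :=
  [/\ is_tree, is_fare,
      (forall i, exists x y, is_path (@pth _ I i) x y) &
      (forall i, 0 < @wgt _ I i)%N].

Definition rooted : Prop :=
  exists r, forall i, exists v, is_path (@pth _ I i) r v.

Definition com_revenue (i : 'I_(nk I)) (F : {set 'I_(ne I)}) : R :=
  if (#|pth i :&: F| <= bnd i)%N
  then (wgt i)%:R * fare I #|pth i :&: F| else 0.

Definition revenue (F : {set 'I_(ne I)}) : R := \sum_(i < nk I) com_revenue i F.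

Definition optimal (F : {set 'I_(ne I)}) : Prop :=
  forall F', revenue F' <= revenue F.

End FareZoneAssignment.

(* Model of computation: a unit-cost random access machine presented as a
   structured language. The memory consists of one-dimensional arrays of
   naturals and of reals, named by numbers fixed in the program text. Naturals
   support +, truncated - and <=, but neither multiplication nor division, so
   that no unit-cost multiplication trick is available. Reals support the
   operations +, -, * and <=; there are no real constants and no way back
   from reals to naturals. The function f is a value oracle [XOra]. *)
Inductive nexp :=
| NCst of nat
| NGet of nat & nexp
| NAdd of nexp & nexp
| NSub of nexp & nexp.

Inductive xexp :=
| XNat of nexp
| XOra of nexp
| XGet of nat & nexp
| XAdd of xexp & xexp
| XSub of xexp & xexp
| XMul of xexp & xexp.

Inductive bexp :=
| BNLe of nexp & nexp
| BXLe of xexp & xexp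
| BNot of bexp
| BAnd of bexp & bexp.

Inductive cmd :=
| Skip
| NSet of nat & nexp & nexp
| XSet of nat & nexp & xexp
| CSeq of cmd & cmd
| Cond of bexp & cmd & cmd
| While of bexp & cmd.

Record state (R : realType) := State {
  nmem : nat -> nat -> nat;
  xmem : nat -> nat -> R
}.

Section Machine.
Variables (R : realType) (f : nat -> R).
Implicit Type s : state R.

Definition upd (T : Type) (mem : nat -> nat -> T) (a j : nat) (v : T) :=
  fun a' j' => if (a' == a) && (j' == j) then v else mem a' j'.

Fixpoint neval s (e : nexp) : nat :=
  match e with
  | NCst c => c
  | NGet a i => nmem s a (neval s i)
  | NAdd e1 e2 => (neval s e1 + neval s e2)%N
  | NSub e1 e2 => (neval s e1 - neval s e2)%N
  end.

Fixpoint xeval s (e : xexp) : R :=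
  match e with
  | XNat i => (neval s i)%:R
  | XOra i => f (neval s i)
  | XGet a i => xmem s a (neval s i)
  | XAdd e1 e2 => xeval s e1 + xeval s e2
  | XSub e1 e2 => xeval s e1 - xeval s e2
  | XMul e1 e2 => xeval s e1 * xeval s e2
  end.

Fixpoint beval s (b : bexp) : bool :=
  match b with
  | BNLe e1 e2 => (neval s e1 <= neval s e2)%N
  | BXLe e1 e2 => xeval s e1 <= xeval s e2
  | BNot b1 => ~~ beval s b1
  | BAnd b1 b2 => beval s b1 && beval s b2
  end.

(* [exec c s t s']: started in s, c halts in s' after t steps. Every assignment
   and every test is one step: the expressions occurring in a program have a
   size that does not depend on the input, so counting each of their operations
   would change t by at most a constant factor. *)
Inductive exec : cmd -> state R -> nat -> state R -> Prop :=
| ESkip s : exec Skip s 1%N s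
| ENSet a i e s :
    exec (NSet a i e) s 1%N
      (State (upd (nmem s) a (neval s i) (neval s e)) (xmem s))
| EXSet a i e s :
    exec (XSet a i e) s 1%N
      (State (nmem s) (upd (xmem s) a (neval s i) (xeval s e)))
| ECSeq c1 c2 s1 t1 s2 t2 s3 :
    exec c1 s1 t1 s2 -> exec c2 s2 t2 s3 -> exec (CSeq c1 c2) s1 (t1 + t2)%N s3
| ECond b c1 c2 s t s' :
    exec (if beval s b then c1 else c2) s t s' -> exec (Cond b c1 c2) s t.+1 s'
| EWhileF b c s : ~~ beval s b -> exec (While b c) s 1%N s
| EWhileT b c s1 t1 s2 t2 s3 :
    beval s1 b -> exec c s1 t1 s2 -> exec (While b c) s2 t2 s3 ->
    exec (While b c) s1 (t1 + t2).+1%N s3.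

End Machine.

Section InputOutput.
Variables (R : realType) (I : fza R).

Definition arr (p : nat) (g : 'I_p -> nat) (j : nat) : nat :=
  if insub j is Some i then g i else 0%N.

(* Array 0 holds |V|, |E| and k; arrays 1 and 2 the ends of the edges; array 3
   the k x |E| incidence matrix of the paths, row by row; arrays 4 and 5 the
   bounds and the weights. All other cells are zero. The root of a rooted
   instance is not part of the input. *)
Definition input_nmem (a : nat) : nat -> nat :=
  match a with
  | 0 => nth 0%N [:: nv I; ne I; nk I]
  | 1 => arr (fun e : 'I_(ne I) => (ends e).1 : nat)
  | 2 => arr (fun e : 'I_(ne I) => (ends e).2 : nat)
  | 3 => nth 0%N [seq nat_of_bool (e \in @pth _ I i)
                 | i <- enum 'I_(nk I), e <- enum 'I_(ne I)]
  | 4 => arr (@bnd _ I)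
  | 5 => arr (@wgt _ I)
  | _ => fun _ => 0%N
  end%N.

Definition input : state R := State input_nmem (fun _ _ => 0).

(* The result is read off array 6, as a characteristic vector. *)
Definition output (s : state R) : {set 'I_(ne I)} :=
  [set e : 'I_(ne I) | nmem s 6 e == 1%N].

End InputOutput.

(* Main.v *)
(** Root the tree at a common endpoint r: a vertex r is an endpoint of every
    nonempty commodity path iff each of them has exactly one edge at r, and all
    such tests together take O(n^2 k) time. Number the vertices 1, 2, ... from
    the root so that parents come first. A cut set F then amounts to the vector
    c of the numbers of cut edges on the root paths, where c(1) = 0 and
    c(t) - c(par t) is 0 or 1, and the revenue of F is a sum over the vertices
    of entries B(u, c(u)) of a table. For t = n, ..., 2, adding
    max(B(t, j), B(t, j+1)) to B(par t, j) eliminates vertex t: the sum over the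
    vertices before t does not decrease for any c, and it is unchanged if c
    chooses the larger entry at t. At the end B(1, 0) bounds every revenue, and
    a top-down pass making the greedy choices attains it. *)

Require Import Defs.
From mathcomp Require Import all_boot all_order all_algebra.
From mathcomp Require Import reals zify.

Set Implicit Arguments.
Unset Strict Implicit.
Unset Printing Implicit Defensive.

Import Order.TTheory GRing.Theory Num.Theory.

(** * Running time of structured programs *)

(** A syntactic over-approximation of the arrays written, so that frame conditions on concrete
    programs are decided by computation. *)
Fixpoint nmods (c : cmd) (a : nat) : bool :=
  match c with
  | NSet a' _ _ => a == a'
  | CSeq c1 c2 => nmods c1 a || nmods c2 a
  | Cond _ c1 c2 => nmods c1 a || nmods c2 a
  | While _ c1 => nmods c1 a
  | _ => false
  end.

Fixpoint xmods (c : cmd) (a : nat) : bool :=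
  match c with
  | XSet a' _ _ => a == a'
  | CSeq c1 c2 => xmods c1 a || xmods c2 a
  | Cond _ c1 c2 => xmods c1 a || xmods c2 a
  | While _ c1 => xmods c1 a
  | _ => false
  end.

Fixpoint nreads (e : nexp) : seq nat :=
  match e with
  | NCst _ => [::]
  | NGet a i => a :: nreads i
  | NAdd e1 e2 => nreads e1 ++ nreads e2
  | NSub e1 e2 => nreads e1 ++ nreads e2
  end.

Definition cell (a : nat) : nexp := NGet a (NCst 0).
Definition NSucc (e : nexp) : nexp := NAdd e (NCst 1).
Definition BLt (e1 e2 : nexp) : bexp := BNLe (NSucc e1) e2.
(** The bound [e] is evaluated anew at every test, which is why [runs_for] forbids the loop to write
    an array that [e] reads. *)
Definition For (x : nat) (e : nexp) (c : cmd) : cmd :=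
  CSeq (NSet x (NCst 0) (NCst 0))
    (While (BLt (cell x) e) (CSeq c (NSet x (NCst 0) (NSucc (cell x))))).

Section TimedHoare.
Variables (R : realType) (f : nat -> R).
Implicit Types (s : state R) (c : cmd) (Q : state R -> Prop).

Definition same c s s' :=
  (forall a j, ~~ nmods c a -> nmem s' a j = nmem s a j) /\
  (forall a j, ~~ xmods c a -> xmem s' a j = xmem s a j).

Lemma same_trans c s1 s2 s3 : same c s1 s2 -> same c s2 s3 -> same c s1 s3.
Proof.
by move=> [h1 h2] [h3 h4]; split=> a j h; [rewrite h3 ?h1 | rewrite h4 ?h2].
Qed.

Lemma same_sub c c' s s' :
  (forall a, nmods c a -> nmods c' a) -> (forall a, xmods c a -> xmods c' a) ->
  same c s s' -> same c' s s'.
Proof.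
move=> hn hx [h1 h2]; split=> a j h; [apply: h1 | apply: h2].
  by apply: contra h; apply: hn.
by apply: contra h; apply: hx.
Qed.

Lemma exec_same c s t s' : exec f c s t s' -> same c s s'.
Proof.
elim=> {c s t s'} //.
- by move=> a i e s; split=> // a' j /= /negbTE h; rewrite /upd h.
- by move=> a i e s; split=> // a' j /= /negbTE h; rewrite /upd h.
- move=> c1 c2 s1 t1 s2 t2 s3 _ h1 _ h2; apply: (@same_trans _ _ s2).
    by apply: same_sub h1 => a /= ->.
  by apply: same_sub h2 => a /= ->; rewrite orbT.
- by move=> b c1 c2 s t s' _; apply: same_sub => a /=; case: beval => ->; rewrite ?orbT.
- by move=> b c s1 t1 s2 t2 s3 _ _ h1 _ h2; apply: same_trans h1 h2.
Qed.

Lemma same_neval c e s s' : all (fun a => ~~ nmods c a) (nreads e) ->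
  same c s s' -> neval s' e = neval s e.
Proof.
move=> h hs; elim: e h => [//|a i IH|e1 IH1 e2 IH2|e1 IH1 e2 IH2] /=.
- by case/andP=> ha hi; rewrite IH // hs.1.
- by rewrite all_cat => /andP[h1 h2]; rewrite IH1 ?IH2.
- by rewrite all_cat => /andP[h1 h2]; rewrite IH1 ?IH2.
Qed.

(** Total correctness with a time budget. As [T] is only an upper bound, both branches of a test can
    share one budget. *)
Definition runs c s T Q :=
  exists t s', [/\ exec f c s t s', t <= T & Q s'].

(** The frame [same c s s'] comes for free, so assertions need not carry along the arrays that [c]
    leaves alone. *)
Lemma runs_weaken c s T T' Q Q' :
  T <= T' -> (forall s', same c s s' -> Q s' -> Q' s') ->
  runs c s T Q -> runs c s T' Q'.
Proof.
move=> hT hQ [t [s' [h1 h2 h3]]]; exists t, s'; split=> //.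
  exact: leq_trans h2 hT.
by apply: hQ h3; apply: exec_same h1.
Qed.

Lemma runs_time c s T T' Q : runs c s T Q -> T <= T' -> runs c s T' Q.
Proof. by move=> h hT; apply: runs_weaken h. Qed.

Lemma runs_skip s Q : Q s -> runs Skip s 1 Q.
Proof. by move=> h; exists 1, s; split=> //; apply: ESkip. Qed.

Lemma runs_nset a i e s Q :
  Q (State (upd (nmem s) a (neval s i) (neval s e)) (xmem s)) ->
  runs (NSet a i e) s 1 Q.
Proof. by move=> h; eexists; eexists; split; [apply: ENSet| |exact: h]. Qed.

Lemma runs_xset a i e s Q :
  Q (State (nmem s) (upd (xmem s) a (neval s i) (xeval f s e))) ->
  runs (XSet a i e) s 1 Q.
Proof. by move=> h; eexists; eexists; split; [apply: EXSet| |exact: h]. Qed.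

Lemma runs_seq c1 c2 s T1 T2 Q :
  runs c1 s T1 (fun s' => runs c2 s' T2 Q) -> runs (CSeq c1 c2) s (T1 + T2) Q.
Proof.
move=> [t1 [s1 [h1 ht1 [t2 [s2 [h2 ht2 hQ]]]]]].
by exists (t1 + t2), s2; split=> //; [apply: ECSeq h1 h2 | apply: leq_add].
Qed.

Lemma runs_bind c1 c2 s T1 T2 Q1 Q :
  runs c1 s T1 Q1 ->
  (forall s', same c1 s s' -> Q1 s' -> runs c2 s' T2 Q) ->
  runs (CSeq c1 c2) s (T1 + T2) Q.
Proof. by move=> h1 h2; apply: runs_seq; apply: runs_weaken h1. Qed.

Lemma runs_cond b c1 c2 s T1 T2 Q :
  (beval f s b -> runs c1 s T1 Q) -> (~~ beval f s b -> runs c2 s T2 Q) ->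
  runs (Cond b c1 c2) s (maxn T1 T2).+1 Q.
Proof.
move=> h1 h2; have [t [s' [h ht hQ]]] :
    runs (if beval f s b then c1 else c2) s (maxn T1 T2) Q.
  case: ifPn => [/h1|/h2]; apply: runs_weaken => //; lia.
by exists t.+1, s'; split=> //; apply: ECond h.
Qed.

Definition set_scalar s x v : state R :=
  State (upd (nmem s) x 0 v) (xmem s).

(** Each round pays for the body, the increment and the test; the final 2 pays for the
    initialisation and the failing test. The invariant is required after the increment, hence
    [set_scalar]. *)
Lemma runs_for x e c T n (Inv : nat -> state R -> Prop) s Q :
  neval s e = n -> ~~ nmods c x ->
  all (fun a => ~~ nmods (For x e c) a) (nreads e) ->
  Inv 0 (set_scalar s x 0) ->
  (forall i s1, i < n -> same (For x e c) s s1 -> nmem s1 x 0 = i -> Inv i s1 ->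
     runs c s1 T (fun s2 => Inv i.+1 (set_scalar s2 x i.+1))) ->
  (forall s1, same (For x e c) s s1 -> Inv n s1 -> Q s1) ->
  runs (For x e c) s (n * T.+2 + 2) Q.
Proof.
move=> hn hx he h0 hbody hQ.
pose w := While (BLt (cell x) e) (CSeq c (NSet x (NCst 0) (NSucc (cell x)))).
(* Induction on the number [k] of rounds left; the frame is kept relative to the initial state
   [s]. *)
have loop k i s1 : i + k = n -> same (For x e c) s s1 -> nmem s1 x 0 = i ->
    Inv i s1 -> runs w s1 (k * T.+2).+1 (fun s2 => same (For x e c) s s2 /\ Inv n s2).
  elim: k i s1 => [|k IH] i s1 hi hs hxi hI.
    exists 1, s1; split=> //.
      by apply: EWhileF; rewrite /= (same_neval he hs) hn hxi; lia.
    by move: hI; rewrite -hi addn0.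
  have lt_in : i < n by lia.
  have [t1 [s2 [h1 ht1 hI2]]] := hbody i s1 lt_in hs hxi hI.
  have hs2 := exec_same h1.
  have hx2 : nmem s2 x 0 = i by rewrite hs2.1.
  pose s3 := set_scalar s2 x i.+1.
  have [|||t2 [s4 [h2 ht2 hI4]]] := IH i.+1 s3 _ _ _ hI2; first by lia.
  - apply: (same_trans hs); apply: (@same_trans _ _ s2).
      apply: same_sub hs2 => a /= ->; rewrite ?orbT ?orTb //.
    split=> // a j /=; rewrite !negb_or => /andP[/negbTE ha _].
    by rewrite /upd ha.
  - by rewrite /= /upd !eqxx.
  exists (t1 + 1 + t2).+1, s4; split=> //.
    apply: (@EWhileT _ _ _ _ _ _ s3); [|apply: (ECSeq h1)|exact: h2].
      by rewrite /= (same_neval he hs) hn hxi; lia.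
    have -> : s3 = State (upd (nmem s2) x (neval s2 (NCst 0))
                (neval s2 (NSucc (cell x)))) (xmem s2).
      by rewrite /s3 /set_scalar /= hx2 addn1.
    exact: ENSet.
  by lia.
rewrite addnS addn1 -add1n.
apply: runs_seq; apply: runs_nset.
apply: (@runs_weaken _ _ _ _ _ Q _ _ (loop n 0 _ _ _ _ h0)) => //.
  by move=> s1 _ [hs hI]; apply: hQ.
- split=> // a j /=; rewrite !negb_or => /andP[/negbTE ha _].
  by rewrite /upd ha.
- by rewrite /= /upd !eqxx.
Qed.

End TimedHoare.

(** * Rooted trees *)

Section Trees.
Variables (R : realType) (I : fza R).
Implicit Types (x y z u v w r : 'I_(nv I)) (e : 'I_(ne I)) (p : seq 'I_(nv I)).
Implicit Types (A F : {set 'I_(ne I)}).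

Lemma joinsC e x y : joins e x y = joins e y x.
Proof. exact: orbC. Qed.

Lemma adj_sym : symmetric (@adj _ I).
Proof. by move=> x y; apply: eq_existsb => e; apply: joinsC. Qed.

Definition incident e v := ((ends e).1 == v) || ((ends e).2 == v).

Lemma joins_incident e x y v : joins e x y -> incident e v = (v == x) || (v == y).
Proof.
rewrite /incident !(eq_sym v).
by case/orP=> /eqP-> //=; rewrite orbC.
Qed.

Lemma joins_same_ends e x y x' y' : joins e x y -> joins e x' y' ->
  (x = x' /\ y = y') \/ (x = y' /\ y = x').
Proof. by rewrite /joins => /orP[] /eqP-> /orP[] /eqP[-> ->]; [left|right|right|left]. Qed.

Lemma path_edges0 x : path_edges x [::] = set0 :> {set 'I_(ne I)}.
Proof. by apply/setP=> e; rewrite !inE. Qed.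

Lemma mem_path_edges_cons e x y p :
  (e \in path_edges x (y :: p)) = joins e x y || (e \in path_edges y p).
Proof. by rewrite !inE. Qed.

Lemma path_edges_cat x p q :
  path_edges x (p ++ q) = path_edges x p :|: path_edges (last x p) q.
Proof.
elim: p x => [|y p IH] x /=; first by rewrite path_edges0 set0U.
by apply/setP=> e; rewrite mem_path_edges_cons IH !in_setU mem_path_edges_cons orbA.
Qed.

Lemma mem_path_edges_rcons e x p y :
  (e \in path_edges x (rcons p y)) = (e \in path_edges x p) || joins e (last x p) y.
Proof.
by rewrite -cats1 path_edges_cat in_setU mem_path_edges_cons path_edges0 in_set0 orbF.
Qed.

Lemma path_edges_rev x p :
  path_edges (last x p) (rev (belast x p)) = path_edges x p.
Proof.
elim: p x => [//|y p IH] x /=; rewrite rev_cons.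
apply/setP=> e; rewrite mem_path_edges_rcons mem_path_edges_cons IH joinsC orbC.
by congr (joins _ _ _ || _); case: p {IH} => //= z p; rewrite rev_cons last_rcons.
Qed.

Lemma incident_path_edges e v x p :
  e \in path_edges x p -> incident e v -> v \in x :: p.
Proof.
elim: p x => [|y p IH] x; first by rewrite path_edges0 inE.
rewrite mem_path_edges_cons => /orP[/joins_incident->|he hv].
  by rewrite !inE => /orP[]->; rewrite ?orbT.
by rewrite inE (IH y) ?orbT.
Qed.

Lemma is_path_rev A x y : is_path A x y -> is_path A y x.
Proof.
case=> p [hp hu <- ->]; exists (rev (belast x p)); split.
- by rewrite rev_path; rewrite (eq_path (e' := @adj _ I)) // => a b; apply: adj_sym.
- by rewrite -rev_rcons -lastI rev_uniq.
- by case: p {hp hu} => //= y' p; rewrite rev_cons last_rcons.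
- by rewrite path_edges_rev.
Qed.

(** * Recognising the ends of a path by counting edges *)

Hypothesis simpleI : simple_graph I.

(** The minimum admits the empty path, of which every vertex counts as an end. *)
Definition end_like A v :=
  #|[set e in A | incident e v]| = minn 1 #|A|.

(** The vertices of the path are distinct, so only its first edge meets [r], and simplicity makes
    that edge unique. *)
Lemma is_path_end_like A r w : is_path A r w -> end_like A r.
Proof.
case=> -[|y p] [/= hp hu _ ->]; rewrite /end_like.
  rewrite path_edges0 cards0; apply/eqP; rewrite minnC /= cards_eq0.
  by apply/eqP/setP=> e; rewrite !inE.
case/andP: hp => /existsP[e he] hp; case/andP: hu => hr hu.
have -> : [set e' in path_edges r (y :: p) | incident e' r] = [set e].
  apply/setP=> e'; rewrite in_set1 inE mem_path_edges_cons.
  apply/andP/eqP=> [[/orP[h _|h1 h2]]|->]; first exact: simpleI.2 h he.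
    by rewrite (incident_path_edges h1 h2) in hr.
  by rewrite he (joins_incident _ he) eqxx.
rewrite cards1; apply/esym/minn_idPl/card_gt0P.
by exists e; rewrite mem_path_edges_cons he.
Qed.

(** An inner vertex has an edge to its predecessor and one to its successor. If these are a single
    edge, both neighbours coincide, which a path without repetition excludes. *)
Lemma end_like_is_path A r w v :
  is_path A r w -> end_like A v -> exists w', is_path A v w'.
Proof.
move=> hA; rewrite /end_like; have [->|A0] := eqVneq A set0.
  by move=> _; exists v, [::]; rewrite path_edges0.
rewrite (minn_idPl _) ?card_gt0 // => /eqP/cards1P[e0 he0].
have /setIdP[e0A e0v] : e0 \in [set e in A | incident e v] by rewrite he0 set11.
have uniq_inc e : e \in A -> incident e v -> e = e0.
  by move=> h1 h2; apply/set1P; rewrite -he0 inE h1.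
have [p [hp hu hw eA]] := hA.
have vp : v \in r :: p by apply: incident_path_edges e0v; rewrite -eA.
case/splitPl: vp => p1 p2 hv in hp hu hw eA.
(* With nothing after [v], the path is reversed; with nothing before it, [v] is [r]. Otherwise the
   two neighbours [last r p1] and [z] are compared. *)
case: p2 => [|z p2] in hp hu hw eA.
  by exists r; apply: is_path_rev; move: hw hv hA; rewrite cats0 => -> <-.
case/lastP: p1 => [|p1 a] in hv hp hu hw eA; first by rewrite -hv; exists w.
rewrite last_rcons in hv; subst a.
move: hp; rewrite cat_path rcons_path last_rcons /=.
case/andP=> /andP[hp1 /existsP[e1 he1]] /andP[/existsP[e2 he2] _].
have e1A : e1 \in A.
  by rewrite eA path_edges_cat in_setU mem_path_edges_rcons he1 orbT.
have e2A : e2 \in A.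
  by rewrite eA path_edges_cat in_setU last_rcons mem_path_edges_cons he2 orbT.
have e12 : e1 = e2.
  apply: (etrans (y := e0)); [|apply: esym]; apply: uniq_inc => //.
    by rewrite (joins_incident _ he1) eqxx orbT.
  by rewrite (joins_incident _ he2) eqxx.
have ez : last r p1 = z.
  by rewrite -e12 in he2; case: (joins_same_ends he1 he2) => [[-> ->]|[]].
move: hu; rewrite -cat_cons cat_uniq => /and3P[_ /hasPn/(_ z)].
by rewrite inE eqxx -ez -rcons_cons mem_rcons inE mem_last orbT => /(_ isT).
Qed.

(** This also describes a partial numbering, where [pos v = 0] marks a vertex not yet reached. [par]
    and [pe] are indexed by numbers rather than vertices and take values in [nat], as they are read
    from memory. *)
Definition numbering r k (pos : 'I_(nv I) -> nat) (par pe : nat -> nat) :=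
  [/\ pos r = 1, (forall v, pos v <= k),
      (forall v w, 0 < pos v -> pos v = pos w -> v = w),
      (forall t, 0 < t <= k -> exists v, pos v = t) &
      (forall v, 1 < pos v -> exists u e,
         [/\ joins e u v, 0 < pos u < pos v, par (pos v) = pos u & pe (pos v) = e])].

Lemma numbering1 r (pos : 'I_(nv I) -> nat) par pe :
  (forall v, pos v = (v == r)) -> numbering r 1 pos par pe.
Proof.
move=> hpos; split=> [|v|v w|t|v]; rewrite ?hpos ?eqxx //; try by case: eqP.
  by case: (v =P r) => // -> _; case: (w =P r) => // ->.
by move=> ht; exists r; rewrite hpos eqxx; lia.
Qed.

(** All numbers in use are at most [k], so [k.+1] is fresh. The new functions are given by pointwise
    equations, which the updated memory satisfies directly. *)
Lemma numbering_append r k pos par pe e u v pos' par' pe' :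
  numbering r k pos par pe -> joins e u v -> 0 < pos u -> pos v = 0 ->
  (forall w, pos' w = if w == v then k.+1 else pos w) ->
  (forall t, par' t = if t == k.+1 then pos u else par t) ->
  (forall t, pe' t = if t == k.+1 then e : nat else pe t) ->
  numbering r k.+1 pos' par' pe'.
Proof.
move=> [pr hk hinj hsurj hpar] huv pu pv hpos' hpar' hpe'.
have neq w : 0 < pos w -> (w == v) = false by apply: contraTF => /eqP->; rewrite pv.
split=> [|w|w w'|t ht|w].
- by rewrite hpos' neq pr.
- by rewrite hpos'; case: ifP => // _; apply: leqW.
- rewrite !hpos'; case: eqP => [->|_]; case: eqP => [->|_] //.
  + by move=> _ h; have := hk w'; lia.
  + by move=> _ h; have := hk w; lia.
  + exact: hinj.
- have [->|nt] := eqVneq t k.+1; first by exists v; rewrite hpos' eqxx.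
  have [|w hw] := hsurj t; first by lia.
  by exists w; rewrite hpos' neq hw //; lia.
- rewrite hpos'; case: eqP => [->|_] hw.
    by exists u, e; rewrite hpar' hpe' eqxx hpos' neq // pu ltnS hk.
  have [u' [e' [h1 /andP[h2 h3] h4 h5]]] := hpar w hw.
  have /negbTE nw : pos w != k.+1 by have := hk w; lia.
  by exists u', e'; rewrite hpar' hpe' hpos' (neq u') // nw h2 h3 h4 h5.
Qed.

(** * Root paths in a completely numbered tree *)

Section Numbering.
Variables (r : 'I_(nv I)) (k : nat) (pos : 'I_(nv I) -> nat) (par pe : nat -> nat).
Hypothesis acyclicI : acyclic I.
Hypothesis numI : numbering r k pos par pe.
Hypothesis pos_gt0 : forall v, 0 < pos v.

Lemma pos_inj : injective pos.
Proof. by case: numI => _ _ h _ _ v w; apply: h. Qed.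

(* The vertices numbered before v are connected among themselves, so a second
   edge from v to one of them would close a cycle through v. *)
Lemma parent_edge e u v : joins e u v -> pos u < pos v ->
  par (pos v) = pos u /\ pe (pos v) = e.
Proof.
move=> huv lt_uv; case: numI => pr _ _ _ hpar.
have lt1v : 1 < pos v by apply: leq_ltn_trans lt_uv.
have [u' [e' [hu' /andP[_ lt_u'v] hp hpe]]] := hpar v lt1v.
have [eu|neu] := eqVneq u' u.
  by rewrite hp hpe eu; split=> //; rewrite eu in hu'; rewrite (simpleI.2 _ _ _ _ hu' huv).
pose q : rel 'I_(nv I) := [rel a b | [&& adj a b, pos a < pos v & pos b < pos v]].
have q_sym : connect_sym q.
  by apply: sym_connect_sym => a b; apply/and3P/and3P=> -[h1 h2 h3]; split; rewrite // adj_sym.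
(* Following parents only lowers the number, so it leads to [r] inside the vertices numbered before
   [v]. *)
have q_r a : pos a < pos v -> connect q a r.
  move: {2}(pos a) (leqnn (pos a)) => n.
  elim: n a => [|n IH] a; first by rewrite leqNgt pos_gt0.
  move=> le_an lt_av; have [h1|h1] := leqP (pos a) 1.
    suff -> : a = r by apply: connect0.
    by apply: pos_inj; have := pos_gt0 a; lia.
  have [b [eb [hb /andP[_ hba] _ _]]] := hpar a h1.
  apply: (connect_trans (y := b)); last by apply: IH; lia.
  apply: connect1; apply/and3P; split; rewrite ?lt_av ?(ltn_trans hba lt_av) //.
  by rewrite adj_sym; apply/existsP; exists eb.
have : connect q u' u.
  by apply: connect_trans (q_r _ lt_u'v) _; rewrite q_sym; apply: q_r.
case/connectP=> p0 hp0 hu0; case/shortenP: hp0 hu0 => p hqp hup _ hu.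
have /acyclicI : ucycle (@adj _ I) (v :: u' :: p).
  apply/andP; split.
    rewrite -[cycle _ _]/(adj v u' && path (@adj _ I) u' (rcons p v)).
    rewrite rcons_path -hu; apply/and3P; split.
    - by rewrite adj_sym; apply/existsP; exists e'.
    - by apply: sub_path hqp => a b /and3P[].
    - by apply/existsP; exists e.
  rewrite cons_uniq hup andbT; apply/negP=> vp.
  have : all (fun a => pos a < pos v) (u' :: p).
    rewrite /= lt_u'v /=; elim: (p) (u') hqp => //= b p' IH a /andP[/and3P[_ _ ->]].
    exact: IH.
  by move/allP/(_ v vp); rewrite ltnn.
(* Having at most two vertices, the cycle [v :: u' :: p] has [p] empty, whence [u = u']. *)
by case: (p) hu => [|? ?] //= eu; rewrite eu eqxx in neu.
Qed.

(** Each edge is the parent edge of its later end, so that end determines it. This turns a factor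
    |E| in the running time into |V|. *)
Lemma ne_le_nv : ne I <= nv I.
Proof.
pose child e := if pos (ends e).1 < pos (ends e).2 then (ends e).2 else (ends e).1.
have childK e : pe (pos (child e)) = e.
  have he : joins e (ends e).1 (ends e).2 by rewrite /joins -surjective_pairing eqxx.
  rewrite /child; case: ltnP => hlt; first by case: (parent_edge he hlt).
  rewrite joinsC in he; case: (parent_edge he) => //; rewrite ltn_neqAle hlt andbT.
  by apply: contra (simpleI.1 e) => /eqP/pos_inj->.
rewrite -[ne I]card_ord -[nv I]card_ord; apply: (@leq_card _ _ child) => e e' h.
by apply: val_inj; rewrite /= -childK h childK.
Qed.

Lemma numbering_size : k <= nv I.
Proof.
case: numI => _ _ _ hs _.
have: {subset iota 1 k <= [seq pos v | v <- enum 'I_(nv I)]}.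
  move=> t; rewrite mem_iota add1n ltnS => /hs[v <-].
  by apply: map_f; rewrite mem_enum.
by move/(uniq_leq_size (iota_uniq _ _)); rewrite size_iota size_map size_enum_ord.
Qed.

Lemma numbering_edge t : 1 < t <= k ->
  exists2 e : 'I_(ne I), pe t = e & 0 < par t < t.
Proof.
case: numI => _ _ _ hs hpar /andP[t1 tk].
have [|v hv] := hs t; first by rewrite tk andbT ltnW.
have [|u [e [_ h1 h2 h3]]] := hpar v; first by rewrite hv.
by exists e; rewrite -hv // h2.
Qed.

(** A common parent edge has the same two ends for both numbers. If they matched crosswise, each
    child would come before the other. *)
Lemma numbering_edge_inj t t' : 1 < t <= k -> 1 < t' <= k -> pe t = pe t' -> t = t'.
Proof.
case: numI => _ _ _ hs hpar /andP[t1 tk] /andP[t1' tk'].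
have [|v hv] := hs t; first by rewrite tk andbT ltnW.
have [|v' hv'] := hs t'; first by rewrite tk' andbT ltnW.
rewrite -hv -hv'.
have [|u [e [j /andP[_ l] _ ->]]] := hpar v; first by rewrite hv.
have [|u' [e' [j' /andP[_ l'] _ ->]]] := hpar v'; first by rewrite hv'.
move/val_inj=> ee; subst e'.
by case: (joins_same_ends j j') => [[_ ->]|[e1 e2]] //; subst; lia.
Qed.

(** A path from the root never turns back: a step to a smaller number would lead to the parent,
    which by induction is the vertex just left. *)
Lemma path_parent p y : path (@adj _ I) r (rcons p y) -> uniq (r :: rcons p y) ->
  par (pos y) = pos (last r p) /\ pos (last r p) < pos y.
Proof.
case: numI => pr _ _ _ _.
elim/last_ind: p y => [|p z IH] y; rewrite rcons_path => /andP[hp /existsP[e he]] hu.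
  have: pos r < pos y.
    rewrite ltn_neqAle pr pos_gt0 andbT -pr (inj_eq pos_inj).
    by move: hu; rewrite /= inE => /andP[].
  by move=> h; split=> //; case: (parent_edge he h).
rewrite last_rcons in he *.
have hz : uniq (r :: rcons p z) by move: hu; rewrite -rcons_cons rcons_uniq => /andP[].
have [hpz ltz] := IH z hp hz.
have [h|h|h] := ltngtP (pos z) (pos y).
- by split=> //; case: (parent_edge he h).
- rewrite joinsC in he; have [] := parent_edge he h; rewrite hpz => /pos_inj ey _.
  move: hu; rewrite -rcons_cons rcons_uniq -ey -rcons_cons mem_rcons inE mem_last.
  by rewrite orbT.
- move/pos_inj: h => ezy; move: hu; rewrite -rcons_cons rcons_uniq -ezy.
  by rewrite -rcons_cons mem_rcons inE eqxx.
Qed.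

Lemma path_edges_parent p y : path (@adj _ I) r (rcons p y) -> uniq (r :: rcons p y) ->
  exists2 e : 'I_(ne I), pe (pos y) = e & path_edges r (rcons p y) = e |: path_edges r p.
Proof.
move=> hp hu; have [h1 h2] := path_parent hp hu.
move: hp; rewrite rcons_path => /andP[hp /existsP[e he]].
exists e; first by case: (parent_edge he h2).
apply/setP=> e'; rewrite mem_path_edges_rcons in_setU1 orbC; congr (_ || _).
by apply/idP/eqP=> [h|-> //]; apply: simpleI.2 h he.
Qed.

(** The far end of a root path is thus the largest number whose parent edge lies on the path (1 if
    there is none). The program locates it this way from the incidence matrix. *)
Lemma path_last_max p : path (@adj _ I) r p -> uniq (r :: p) ->
  (1 < pos (last r p) -> exists2 e : 'I_(ne I), pe (pos (last r p)) = e & e \in path_edges r p) /\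
  (forall t e, 1 < t <= k -> e \in path_edges r p -> pe t = e -> t <= pos (last r p)).
Proof.
case: numI => pr hk _ hs hpar.
elim/last_ind: p => [|p y IH] hp hu.
  by rewrite /= pr; split=> // t e _; rewrite path_edges0 inE.
have [h1 h2] := path_parent hp hu; have [e he hE] := path_edges_parent hp hu.
rewrite last_rcons; split=> [_|t e' ht]; first by exists e; rewrite ?hE ?setU11.
rewrite hE in_setU1 => /orP[/eqP->|h] et; last first.
  have hu' : uniq (r :: p) by move: hu; rewrite -rcons_cons rcons_uniq => /andP[].
  have hp' : path (@adj _ I) r p by move: hp; rewrite rcons_path => /andP[].
  by apply: leq_trans (ltnW h2); apply: (IH hp' hu').2 h et.
have y1 : 1 < pos y <= k by rewrite hk andbT; apply: leq_ltn_trans h2; apply: pos_gt0.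
by rewrite (numbering_edge_inj ht y1) // et he.
Qed.

(** Induction along the path: the step to [y] appends the parent edge of [y], and [c] grows by one
    exactly if this edge is cut. *)
Lemma card_path_edges F (c : nat -> nat) p :
  c 1 = 0 ->
  (forall t e, 1 < t <= k -> pe t = e -> c t = c (par t) + (e \in F)) ->
  path (@adj _ I) r p -> uniq (r :: p) ->
  #|path_edges r p :&: F| = c (pos (last r p)).
Proof.
case: numI => pr hk _ _ _ c1 hc.
elim/last_ind: p => [|p y IH] hp hu.
  by rewrite path_edges0 set0I cards0 /= pr c1.
have [h1 h2] := path_parent hp hu; have [e he hE] := path_edges_parent hp hu.
have hu' : uniq (r :: p) by move: hu; rewrite -rcons_cons rcons_uniq => /andP[].
have hp' : path (@adj _ I) r p by move: hp; rewrite rcons_path => /andP[].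
have y1 : 1 < pos y <= k by rewrite hk andbT; apply: leq_ltn_trans h2; apply: pos_gt0.
rewrite last_rcons (hc _ _ y1 he) h1 -(IH hp' hu') hE setIUl.
(* An earlier occurrence of [e] would force the number of [y] to be at most that of its
   predecessor. *)
have enp : e \notin path_edges r p.
  apply/negP=> h; have := (path_last_max hp' hu').2 _ _ y1 h he.
  by rewrite leqNgt h2.
case: (boolP (e \in F)) => eF.
  have -> : [set e] :&: F = [set e] by apply/setIidPl; rewrite sub1set.
  by rewrite cardsU1 inE negb_and enp /= addnC.
have -> : [set e] :&: F = set0.
  by apply/setP=> e'; rewrite !inE; case: eqP => // ->; rewrite (negbTE eF).
by rewrite set0U addn0.
Qed.

End Numbering.

(** The recursion for [c] is well founded since parents have smaller numbers; one value is added at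
    a time. *)
Lemma exists_count k (par g : nat -> nat) :
  (forall t, 1 < t <= k -> 0 < par t < t) ->
  exists2 c : nat -> nat, c 1 = 0 & forall t, 1 < t <= k -> c t = c (par t) + g t.
Proof.
elim: k => [|k IH] hpar; first by exists (fun _ => 0) => // t; lia.
have [|c c1 hc] := IH; first by move=> t ht; apply: hpar; lia.
have [k1|k1] := leqP k.+1 1; first by exists c => // t ht; apply: hc; lia.
exists (fun t => if t == k.+1 then c (par t) + g t else c t) => [|t ht].
  by rewrite ifN //; lia.
have := hpar t ht; case: eqP => [-> h|ntk h]; first by rewrite ifN //; lia.
by rewrite ifN; [apply: hc|]; lia.
Qed.

End Trees.

(** * The program *)

(** One step of symbolic execution. Time budgets are left to unification; [runs_time] then compares
    their total with the stated bound. *)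
Ltac run :=
  first [ eapply runs_skip | eapply runs_nset | eapply runs_xset
        | eapply runs_seq | eapply runs_cond ]; cbv beta.

(* Scalars occupy cell 0 of their array. Vertex numbers start at 1, and
   aPOS v = 0 means that v has no number yet; aPAR and aPE give the parent and
   the parent edge of a number. *)
Local Notation aX := 7.
Local Notation aY := 8.
Local Notation aZ := 9.
Local Notation aROOT := 10.
Local Notation aOK := 11.
Local Notation aSZ := 12.
Local Notation aINC := 13.
Local Notation aPOS := 14.
Local Notation aCNT := 15.
Local Notation aPAR := 16.
Local Notation aPE := 17.
Local Notation aMROW := 18.
Local Notation aROW := 19.
Local Notation aEND := 20.
Local Notation aCUR := 21.

Definition nV : nexp := NGet 0 (NCst 0).
Definition nE : nexp := NGet 0 (NCst 1).
Definition nK : nexp := NGet 0 (NCst 2).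

Definition set0c (a : nat) (e : nexp) : cmd := NSet a (NCst 0) e.
Definition BEq (e1 e2 : nexp) : bexp := BAnd (BNLe e1 e2) (BNLe e2 e1).
Definition BOr (b1 b2 : bexp) : bexp := BNot (BAnd (BNot b1) (BNot b2)).

(* Multiplication being unavailable, the offsets of the rows of the incidence
   matrix (width |E|) and of the table (width |V| + 1) are tabulated. *)
Definition init_rows : cmd :=
  CSeq
    (For aX nK (NSet aMROW (NSucc (cell aX)) (NAdd (NGet aMROW (cell aX)) nE)))
    (For aX nV (NSet aROW (NSucc (cell aX)) (NAdd (NGet aROW (cell aX)) (NSucc nV)))).

Definition mat (i e : nexp) : nexp := NGet 3 (NAdd (NGet aMROW i) e).

(** With truncated subtraction, 1 - (1 - x) is the minimum of 1 and x, so the inner test is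
    [end_like] for one commodity. *)
Definition find_root : cmd :=
  For aX nV
    (CSeq (set0c aOK (NCst 1))
    (CSeq (For aY nK
      (CSeq (set0c aSZ (NCst 0))
      (CSeq (set0c aINC (NCst 0))
      (CSeq (For aZ nE
        (CSeq (set0c aSZ (NAdd (cell aSZ) (mat (cell aY) (cell aZ))))
          (Cond (BOr (BEq (NGet 1 (cell aZ)) (cell aX))
                     (BEq (NGet 2 (cell aZ)) (cell aX)))
            (set0c aINC (NAdd (cell aINC) (mat (cell aY) (cell aZ))))
            Skip)))
        (Cond (BEq (cell aINC) (NSub (NCst 1) (NSub (NCst 1) (cell aSZ))))
          Skip (set0c aOK (NCst 0)))))))
      (Cond (BNLe (NCst 1) (cell aOK)) (set0c aROOT (cell aX)) Skip))).

(** Here [a] and [b] are the end arrays 1 and 2 in either order: the edge is crossed from its end in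
    [a], already numbered, to its end in [b]. *)
Definition append_vertex (a b : nat) : cmd :=
  CSeq (set0c aCNT (NSucc (cell aCNT)))
  (CSeq (NSet aPAR (cell aCNT) (NGet aPOS (NGet a (cell aY))))
  (CSeq (NSet aPE (cell aCNT) (cell aY))
    (NSet aPOS (NGet b (cell aY)) (cell aCNT)))).

Definition crosses (a b : nat) : bexp :=
  BAnd (BNLe (NCst 1) (NGet aPOS (NGet a (cell aY))))
       (BNLe (NGet aPOS (NGet b (cell aY))) (NCst 0)).

Definition number_vertices : cmd :=
  CSeq (NSet aPOS (cell aROOT) (NCst 1))
  (CSeq (set0c aCNT (NCst 1))
    (For aX nV (For aY nE
      (Cond (crosses 1 2) (append_vertex 1 2)
        (Cond (crosses 2 1) (append_vertex 2 1) Skip))))).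

(** * Access to the instance in memory *)

Section Input.
Variables (R : realType) (I : fza R).
Local Notation n := (nv I).
Local Notation m := (ne I).
Implicit Types (s : state R) (r v : 'I_(nv I)).

Lemma nth_allpairs (S T : Type) (U : Type) (x0 : U) (a0 : S) (b0 : T)
    (g : S -> T -> U) (s : seq S) (t : seq T) i j :
  i < size s -> j < size t ->
  nth x0 [seq g a b | a <- s, b <- t] (i * size t + j) = g (nth a0 s i) (nth b0 t j).
Proof.
elim: s i => [//|a s IH] [|i] hi hj; rewrite allpairs_cons nth_cat size_map.
  by rewrite mul0n add0n hj (nth_map b0).
rewrite mulSn -addnA ifN; last by lia.
by rewrite addKn IH.
Qed.

Lemma arrE p (g : 'I_p -> nat) (j : 'I_p) : arr g j = g j.
Proof. by rewrite /arr valK. Qed.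

(** The part of the memory that every phase after [init_rows] only reads. *)
Definition ready s :=
  [/\ (forall a j, a < 6 -> nmem s a j = input_nmem I a j),
      (forall i, i <= nk I -> nmem s aMROW i = i * m) &
      (forall u, u <= n -> nmem s aROW u = u * n.+1)].

Definition kept := [:: 0; 1; 2; 3; 4; 5; aMROW; aROW].

Lemma ready_same c s s' :
  same c s s' -> ready s -> all (fun a => ~~ nmods c a) kept -> ready s'.
Proof.
move=> hs [h1 h2 h3] /allP hc; split=> [a j ha|i hi|u hu].
- by rewrite hs.1 ?h1 //; apply: hc; case: a ha => [|[|[|[|[|[|a]]]]]].
- by rewrite hs.1 ?h2 //; apply: hc.
- by rewrite hs.1 ?h3 //; apply: hc.
Qed.

Lemma ready_upd a j (x : nat) s :
  a \notin kept -> ready s -> ready (State (upd (nmem s) a j x) (xmem s)).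
Proof.
move=> ha rs; apply: (@ready_same (NSet a (NCst 0) (NCst 0)) s) => //.
  by split=> // a' j' /= /negbTE h; rewrite /upd h.
by apply/allP => a' ha' /=; apply: contraNneq ha => <-.
Qed.

Section Ready.
Variable s : state R.
Hypothesis rs : ready s.

Lemma ready_nv : nmem s 0 0 = n. Proof. by case: rs => ->. Qed.
Lemma ready_ne : nmem s 0 1 = m. Proof. by case: rs => ->. Qed.
Lemma ready_nk : nmem s 0 2 = nk I. Proof. by case: rs => ->. Qed.
Lemma ready_end1 (e : 'I_m) : nmem s 1 e = (ends e).1.
Proof. by case: rs => -> // _ _ /=; rewrite arrE. Qed.
Lemma ready_end2 (e : 'I_m) : nmem s 2 e = (ends e).2.
Proof. by case: rs => -> // _ _ /=; rewrite arrE. Qed.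
Lemma ready_mat (i : 'I_(nk I)) (e : 'I_m) : nmem s 3 (nmem s aMROW i + e) = (e \in pth i).
Proof.
case: rs => h1 h2 _; rewrite h1 // h2; last exact: ltnW.
rewrite /=.
have := @nth_allpairs _ _ _ 0 i e (fun i e => nat_of_bool (e \in @pth _ I i))
  (enum 'I_(nk I)) (enum 'I_m) i e.
by rewrite !size_enum_ord !nth_ord_enum => ->.
Qed.
Lemma ready_bnd (i : 'I_(nk I)) : nmem s 4 i = bnd i.
Proof. by case: rs => -> // _ _ /=; rewrite arrE. Qed.
Lemma ready_wgt (i : 'I_(nk I)) : nmem s 5 i = wgt i.
Proof. by case: rs => -> // _ _ /=; rewrite arrE. Qed.
Lemma ready_row u : u <= n -> nmem s aROW u = u * n.+1.
Proof. by case: rs => _ _; apply. Qed.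
End Ready.

Variable f : nat -> R.

Lemma runs_init_rows :
  runs f init_rows (input I) (3 * nk I + 3 * n + 4) ready.
Proof.
eapply runs_time.
  run.
  apply: (@runs_for _ f aX _ _ 1 (nk I)
    (fun x s => forall i, i <= x -> nmem s aMROW i = i * m)) => //.
    by move=> [|i].
  - move=> x s1 hx hs ex h; run => i; rewrite /= /upd /= ex addn1.
    rewrite leq_eqVlt => /orP[/eqP->|hi].
      by rewrite eqxx h // (hs.1 0 _ isT) /= mulSn addnC.
    by rewrite ltn_eqF // h.
  move=> s1 hs h1.
  apply: (@runs_for _ f aX _ _ 1 n
    (fun x s => forall i, i <= x -> nmem s aROW i = i * n.+1)) => //.
  - by rewrite /= (hs.1 0 _ isT).
  - by move=> i; rewrite /= /upd /= (hs.1 aROW _ isT); case: i.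
  - move=> x s2 hx hs2 ex h; run => i; rewrite /= /upd /= ex addn1.
    rewrite leq_eqVlt => /orP[/eqP->|hi].
      by rewrite eqxx h // (hs2.1 0 _ isT) (hs.1 0 _ isT) /= mulSn; lia.
    by rewrite ltn_eqF // h.
  move=> s2 hs2 h2; split=> [a j ha|i hi|//].
    rewrite hs2.1; last by case: a ha => [|[|[|[|[|[|a]]]]]].
    by rewrite hs.1; last by case: a ha => [|[|[|[|[|[|a]]]]]].
  by rewrite (hs2.1 aMROW _ isT) h1.
lia.
Qed.

Lemma end_like_sum (A : {set 'I_m}) v :
  end_like A v <->
  \sum_(e < m) (e \in A) * incident e v = minn 1 (\sum_(e < m) (e \in A)).
Proof.
have -> : \sum_(e < m) (e \in A) * incident e v = #|[set e in A | incident e v]|.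
  rewrite -sum1_card [RHS]big_mkcond; apply: eq_bigr => e _.
  by rewrite !inE; case: (_ \in _); case: incident.
have -> // : \sum_(e < m) (e \in A) = #|A|.
by rewrite -sum1_card [RHS]big_mkcond; apply: eq_bigr => e _; case: (_ \in _).
Qed.

End Input.

(** * Sums over initial segments, for loop invariants *)

Section PartialSums.
Variables (T : Type) (idx : T) (op : Monoid.com_law idx) (p : nat) (F : 'I_p -> T).

Lemma big_lt0 : \big[op/idx]_(j < p | j < 0) F j = idx.
Proof. exact: big_pred0. Qed.

Lemma big_ltS (i : 'I_p) :
  \big[op/idx]_(j < p | j < i.+1) F j = op (\big[op/idx]_(j < p | j < i) F j) (F i).
Proof.
rewrite (bigD1 i) ?ltnSn //= Monoid.mulmC; congr (op _ _).
by apply: eq_bigl => j; rewrite ltnS [RHS]ltn_neqAle andbC.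
Qed.

Lemma big_lt_ord : \big[op/idx]_(j < p | j < p) F j = \big[op/idx]_(j < p) F j.
Proof. by apply: eq_bigl => j; rewrite ltn_ord. Qed.

End PartialSums.

(** * Search for a common endpoint *)

Section RootSearch.
Variables (R : realType) (I : fza R) (f : nat -> R).
Local Notation n := (nv I).
Local Notation m := (ne I).
Implicit Types (s : state R) (r v : 'I_(nv I)).

Lemma runs_find_root s :
  ready I s -> (exists r, forall i, end_like (@pth _ I i) r) ->
  runs f find_root s (n * (nk I * (m * 5 + 8) + 7) + 2)
    (fun s' => exists2 v : 'I_n, nmem s' aROOT 0 = v
                               & forall i, end_like (@pth _ I i) v).
Proof.
move=> rs [r hr].
eapply runs_time.
  (* The invariant is an implication because [aROOT] is meaningless until a vertex has passed all
     tests. *)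
  apply: (@runs_for _ f aX _ _ (nk I * (m * 5 + 8) + 5) n
    (fun x s' => (exists2 v : 'I_n, v < x & forall i, end_like (@pth _ I i) v) ->
       exists2 v : 'I_n, nmem s' aROOT 0 = v
                       & forall i, end_like (@pth _ I i) v)) => //.
  - by rewrite /= (ready_nv rs).
  - by case.
  - move=> x s1 hx hs1 ex1 hI; have rs1 := ready_same hs1 rs isT.
    pose v := Ordinal hx.
    eapply runs_time.
      run; run; run.
      apply: (@runs_for _ f aY _ _ (m * 5 + 6) (nk I)
        (fun y s' => 0 < nmem s' aOK 0 <->
           forall i : 'I_(nk I), i < y -> end_like (@pth _ I i) v)) => //.
      + by rewrite /= /upd /= (ready_nk rs1).
      + move=> y s2 hy hs2 ey2 hI2; pose i := Ordinal hy.
        have ex2 : nmem s2 aX 0 = v by rewrite (hs2.1 aX _ isT).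
        have rs2 : ready I s2.
          by apply: (ready_same hs2) => //; do ?apply: ready_upd.
        eapply runs_time.
          run; run; run; run; run.
          apply: (@runs_for _ f aZ _ _ 3 m
            (fun z s' =>
               nmem s' aSZ 0 = \sum_(e < m | e < z) (e \in pth i) /\
               nmem s' aINC 0 = \sum_(e < m | e < z) (e \in pth i) * incident e v)) => //.
          * by rewrite /= /upd /= (ready_ne rs2).
          * by rewrite /= /upd /= !big_lt0.
          * move=> z s3 hz hs3 ez3 [hS hC]; pose e := Ordinal hz.
            have ex3 : nmem s3 aX 0 = v by rewrite (hs3.1 aX _ isT).
            have ey3 : nmem s3 aY 0 = i by rewrite (hs3.1 aY _ isT).
            have rs3 : ready I s3.
              by apply: (ready_same hs3) => //; do ?apply: ready_upd.
            have em : nmem s3 3 (nmem s3 aMROW (nmem s3 aY 0) + nmem s3 aZ 0) = (e \in pth i).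
              by rewrite ey3 ez3 -[z]/(val e) ready_mat.
            eapply runs_time.
              run; run; run;
                rewrite /= /upd /= ?em ex3 ez3 (ready_end1 rs3 e) (ready_end2 rs3 e)
                  -!eqn_leq -negb_or ?negbK -/(incident e v) => hinc; run;
                rewrite /= /upd /= ?em hS hC !(big_ltS _ _ e) /=.
            -- by rewrite hinc muln1.
            -- by rewrite (negbTE hinc) muln0 addn0.
            lia.
          move=> s3 hs3 [hS hC].
          have eOK : nmem s3 aOK 0 = nmem s2 aOK 0 by rewrite (hs3.1 aOK _ isT).
          have split_last (P : 'I_(nk I) -> Prop) :
              (forall j : 'I_(nk I), j < y.+1 -> P j) <->
              (forall j : 'I_(nk I), j < y -> P j) /\ P i.
            split=> [h|[h1 h2] j].
              by split=> [j hj|]; apply: h => //; apply: ltnW.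
            rewrite ltnS leq_eqVlt => /orP[/eqP ej|]; last exact: h1.
            by have -> : j = i by apply: val_inj.
          have hi : end_like (pth i) v <-> nmem s3 aINC 0 = 1 - (1 - nmem s3 aSZ 0).
            have -> (k : nat) : 1 - (1 - k) = minn 1 k by lia.
            by rewrite hS hC !big_lt_ord end_like_sum.
          run; rewrite /= -eqn_leq => /eqP hb; run; rewrite /= /upd /= split_last.
          + rewrite eOK hI2; split=> [h|[]//]; split=> //.
            exact/hi.
          + by split=> // -[_ /hi].
        lia.
      move=> s2 hs2 hI2.
      have ex2 : nmem s2 aX 0 = v by rewrite (hs2.1 aX _ isT).
      run => /= hb; run; rewrite /= /upd /=.
      + by move=> _; exists v => //; move/hI2: hb => h i; apply: h.
      + move=> [w]; rewrite ltnS leq_eqVlt => /orP[/eqP ew hw|hw1 hw2].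
          have ev : w = v by apply: val_inj.
          by case/negP: hb; apply/hI2 => i _; rewrite -ev.
        by rewrite (hs2.1 aROOT _ isT) /=; apply: hI; exists w.
    lia.
  by move=> s1 hs1 hI; apply: hI; exists r.
lia.
Qed.

End RootSearch.

(** * Numbering the tree from the root *)

Section VertexNumbering.
Variables (R : realType) (I : fza R) (f : nat -> R).
Local Notation n := (nv I).
Local Notation m := (ne I).
Implicit Types (s : state R) (r u v w : 'I_(nv I)) (e : 'I_(ne I)).

Definition numbered r s :=
  numbering r (nmem s aCNT 0) (fun v => nmem s aPOS v) (nmem s aPAR) (nmem s aPE).

Lemma runs_append_vertex (d : bool) s r e u v :
  let a := if d then 1 else 2 in let b := if d then 2 else 1 in
  nmem s aY 0 = e -> nmem s a e = u -> nmem s b e = v -> joins e u v ->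
  0 < nmem s aPOS u -> nmem s aPOS v = 0 -> numbered r s ->
  runs f (append_vertex a b) s 4
    (fun s' => [/\ numbered r s', 0 < nmem s' aPOS v &
                   forall w, 0 < nmem s aPOS w -> 0 < nmem s' aPOS w]).
Proof.
move=> a b hy ha hb huv pu pv hn; rewrite /append_vertex /a /b.
eapply runs_time.
  do 7!run; case: d @a @b ha hb => /= ha hb; rewrite /numbered /= /upd /= hy ha hb !addn1.
    split=> [||w hw]; [|by rewrite eqxx|by case: eqP].
    by apply: (numbering_append hn huv pu pv) => t; rewrite ?andbT.
  split=> [||w hw]; [|by rewrite eqxx|by case: eqP].
  by apply: (numbering_append hn huv pu pv) => t; rewrite ?andbT.
lia.
Qed.

(** As in the Bellman-Ford method, [x] rounds over all edges number at least the ends of all paths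
    of at most [x] edges from [r]. A path without repetition has fewer than [n] edges. *)
Lemma runs_number_vertices s r :
  ready I s -> nmem s aROOT 0 = r -> (forall j, nmem s aPOS j = 0) ->
  (forall x y, connect (@adj _ I) x y) ->
  runs f number_vertices s (n * (m * 8 + 4) + 4)
    (fun s' => numbered r s' /\ forall v, 0 < nmem s' aPOS v).
Proof.
move=> rs hr hpos0 hconn.
eapply runs_time.
  run; run; run; run.
  set s1 := State _ _.
  have rs1 : ready I s1 by do 2!apply: ready_upd => //.
  apply: (@runs_for _ f aX _ _ (m * 8 + 2) n
    (fun x s' => numbered r s' /\ forall p, path (@adj _ I) r p -> size p <= x ->
       0 < nmem s' aPOS (last r p))) => //.
  - by rewrite /= /upd /= (ready_nv rs).
  - split.
      rewrite /numbered /= /upd /=. apply: numbering1 => v.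
      by rewrite hr hpos0 (inj_eq val_inj); case: eqP.
    by case=> // _ _; rewrite /= /upd /= hr eqxx.
  - move=> x s2 hx hs2 ex [hn2 hp2].
    have rs2 := ready_same hs2 rs1 isT.
    eapply runs_time.
      (* The premises refer to the state [s2] at the start of the round; with the current state, an
         edge treated early could lose its property when one of its ends is numbered later. *)
      apply: (@runs_for _ f aY _ _ 6 m
        (fun y s' => [/\ numbered r s',
           forall w, 0 < nmem s2 aPOS w -> 0 < nmem s' aPOS w &
           forall e, e < y ->
             (0 < nmem s2 aPOS (ends e).1 -> 0 < nmem s' aPOS (ends e).2) /\
             (0 < nmem s2 aPOS (ends e).2 -> 0 < nmem s' aPOS (ends e).1)])) => //.
      + by rewrite /= (ready_ne rs2).
      + move=> y s3 hy hs3 ey [hn3 hm3 he3].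
        have rs3 := ready_same hs3 rs2 isT.
        pose e := Ordinal hy.
        have hj : joins e (ends e).1 (ends e).2 by rewrite /joins -surjective_pairing eqxx.
        have e1 := ready_end1 rs3 e; have e2 := ready_end2 rs3 e.
        have step s4 : numbered r s4 ->
            (forall w, 0 < nmem s3 aPOS w -> 0 < nmem s4 aPOS w) ->
            (0 < nmem s2 aPOS (ends e).1 -> 0 < nmem s4 aPOS (ends e).2) ->
            (0 < nmem s2 aPOS (ends e).2 -> 0 < nmem s4 aPOS (ends e).1) ->
            [/\ numbered r s4,
              forall w, 0 < nmem s2 aPOS w -> 0 < nmem s4 aPOS w &
              forall e, e < y.+1 ->
               (0 < nmem s2 aPOS (ends e).1 -> 0 < nmem s4 aPOS (ends e).2) /\
               (0 < nmem s2 aPOS (ends e).2 -> 0 < nmem s4 aPOS (ends e).1)].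
          move=> hn4 hm4 h1 h2; split=> // [w /hm3/hm4 //|e'].
          rewrite ltnS leq_eqVlt => /orP[/eqP ee|/he3[h3 h4]].
            by have -> : e' = e by apply: val_inj.
          by split=> [/h3|/h4]; apply: hm4.
        eapply runs_time.
          run.
            rewrite /= ey -[y]/(val e) e1 e2 => /andP[p1 p2].
            apply: runs_weaken (@runs_append_vertex true s3 r e (ends e).1 (ends e).2
              ey e1 e2 hj p1 _ hn3); [exact: leqnn| |by apply/eqP; rewrite -leqn0].
            move=> s4 _ [hn4 pv hm4].
            by apply: (step s4) => // _; apply: hm4.
          move=> /= hb1; run.
            rewrite /= ey -[y]/(val e) e1 e2 => /andP[p2 p1].
            rewrite joinsC in hj.
            apply: runs_weaken (@runs_append_vertex false s3 r e (ends e).2 (ends e).1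
              ey e2 e1 hj p2 _ hn3); [exact: leqnn| |by apply/eqP; rewrite -leqn0].
            move=> s4 _ [hn4 pv hm4].
            by apply: (step s4) => // _; apply: hm4.
          move=> /= hb2; run.
          move: hb1 hb2; rewrite ey -[y]/(val e) e1 e2 => hb1 hb2.
          by apply: (step s3) => // /hm3; lia.
        lia.
      move=> s3 hs3 [hn3 hm3 he3]; split=> // p.
      case/lastP: p => [_ _|p z]; first exact/hm3/(hp2 [::]).
      rewrite rcons_path size_rcons last_rcons ltnS => /andP[hp /existsP[e he]] hsz.
      have := hp2 p hp hsz; have := he3 e (ltn_ord e).
      by case/orP: he => /eqP-> /= [h1 h2].
    lia.
  move=> s2 hs2 [hn2 hp2]; split=> // v.
  have /connectP[p0 hp0 ->] := hconn r v; case/shortenP: hp0 => p hp hu _.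
  apply: hp2 => //; apply: ltnW; have := max_card (mem (r :: p)).
  by rewrite card_ord (card_uniqP hu).
lia.
Qed.

End VertexNumbering.

(** * The dynamic program *)

Definition entry (u j : nexp) : nexp := NAdd (NGet aROW u) j.

(** The scan for the path's end runs upwards, so the largest number is stored last in [aEND].
    Counter [aY] stands for number [aY + 1], and its value 0, the root, has no parent edge to look
    up. *)
Definition fill_table : cmd :=
  For aX nK
    (CSeq (set0c aEND (NCst 1))
    (CSeq (For aY (cell aCNT)
      (Cond (BAnd (BNLe (NCst 1) (cell aY))
                  (BNLe (NCst 1) (mat (cell aX) (NGet aPE (NSucc (cell aY))))))
        (set0c aEND (NSucc (cell aY))) Skip))
      (For aZ nV
        (Cond (BNLe (cell aZ) (NGet 4 (cell aX)))
          (XSet 0 (entry (cell aEND) (cell aZ))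
            (XAdd (XGet 0 (entry (cell aEND) (cell aZ)))
               (XMul (XNat (NGet 5 (cell aX))) (XOra (cell aZ)))))
          Skip)))).

Definition add_to_parent (j : nexp) : cmd :=
  XSet 0 (entry (NGet aPAR (cell aY)) (cell aZ))
    (XAdd (XGet 0 (entry (NGet aPAR (cell aY)) (cell aZ)))
          (XGet 0 (entry (cell aY) j))).

(** Both passes share this test. Column [aZ + 1] may equal |V|, hence the row width |V| + 1. *)
Definition better_cut : bexp :=
  BXLe (XGet 0 (entry (cell aY) (cell aZ)))
       (XGet 0 (entry (cell aY) (NSucc (cell aZ)))).

Definition sweep_up : cmd :=
  For aX (NSub (cell aCNT) (NCst 1))
    (CSeq (set0c aY (NSub (cell aCNT) (cell aX)))
      (For aZ nV
        (Cond better_cut (add_to_parent (NSucc (cell aZ))) (add_to_parent (cell aZ))))).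

Definition sweep_down : cmd :=
  For aX (NSub (cell aCNT) (NCst 1))
    (CSeq (set0c aY (NAdd (cell aX) (NCst 2)))
    (CSeq (set0c aZ (NGet aCUR (NGet aPAR (cell aY))))
      (Cond better_cut
        (CSeq (NSet 6 (NGet aPE (cell aY)) (NCst 1))
          (NSet aCUR (cell aY) (NSucc (cell aZ))))
        (NSet aCUR (cell aY) (cell aZ))))).

(** * Elimination of one vertex from the table *)

Section DynamicProgram.
Variables (R : realType) (par : nat -> nat).
Implicit Types (B : nat -> nat -> R) (c : nat -> nat).

Definition table_sum B c t : R := (\sum_(1 <= u < t.+1) B u (c u))%R.

(** The comparison counts as 0 or 1; ties are cut, as in [better_cut]. *)
Definition greedy B c t :=
  c t = c (par t) + (B t (c (par t)) <= B t (c (par t)).+1)%R.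

Definition admissible k c :=
  c 1 = 0 /\ forall t, 1 < t <= k -> c t = c (par t) \/ c t = (c (par t)).+1.

(** Passing from a parent to a larger number adds at most one. Hence columns below |V| hold every
    entry that a cut set can select. *)
Lemma admissible_lt k c : (forall t, 1 < t <= k -> 0 < par t < t) ->
  admissible k c -> forall t, 0 < t <= k -> c t < t.
Proof.
move=> hpar [c1 hc] t; elim/ltn_ind: t => t IH ht.
have [t1|t1] := leqP t 1.
  have -> : t = 1 by lia.
  by rewrite c1.
have h : 1 < t <= k by lia.
have h2 := hpar t h; have h3 : c (par t) < par t by apply: IH; lia.
by case: (hc t h) => ->; lia.
Qed.

Lemma sum_delta (F : nat -> R) t p : 0 < p <= t ->
  (\sum_(1 <= u < t.+1) (if u == p then F u else 0) = F p)%R.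
Proof. by move=> hp; rewrite -big_mkcond big_nat1_eq ltnS hp. Qed.

(** The entry of [c] at [t] is one of the two compared, hence at most the maximum moved to the
    parent. Only entries selected by [c] are constrained, as the program updates just the columns
    below |V|. *)
Lemma table_sum_step B B' c k t :
  (forall t, 1 < t <= k -> 0 < par t < t) -> 1 < t <= k -> admissible k c ->
  (forall u, (0 < u < t)%N -> B' u (c u) = B u (c u) +
      if u == par t then Num.max (B t (c u)) (B t (c u).+1) else 0)%R ->
  (table_sum B c t <= table_sum B' c t.-1)%R /\
  (greedy B c t -> table_sum B c t = table_sum B' c t.-1).
Proof.
case: t => // t hpar ht [c1 hc] hB /=; have hp := hpar _ ht.
have -> : table_sum B' c t = (table_sum B c t + Num.max (B t.+1 (c (par t.+1)))
                                      (B t.+1 (c (par t.+1)).+1))%R.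
  rewrite /table_sum.
  (* The maximum is written as a sum over all rows that vanishes off the parent, so that it merges
     with the sum of [B]. *)
  rewrite -(@sum_delta (fun u => Num.max (B t.+1 (c u)) (B t.+1 (c u).+1)) t); last by lia.
  rewrite -big_split /= big_nat_cond [RHS]big_nat_cond; apply: eq_bigr => u hu.
  by rewrite hB //; lia.
rewrite /table_sum big_nat_recr //=; split.
  rewrite lerD2l le_max.
  by case: (hc _ ht) => ->; rewrite lexx ?orbT.
by rewrite /greedy; case: leP => h ->; rewrite ?addn1 ?addn0.
Qed.

End DynamicProgram.

(** * Filling the table with the gains of the commodities *)

Section Table.
Variables (R : realType) (I : fza R).
Local Notation n := (nv I).
Local Notation m := (ne I).
Implicit Types (s : state R) (r v : 'I_(nv I)) (e : 'I_(ne I)).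

Definition tab s (u j : nat) : R := xmem s 0 (u * n.+1 + j).

Definition gain (i : 'I_(nk I)) (j : nat) : R :=
  if j <= bnd i then ((wgt i)%:R * fare I j)%R else 0%R.

(** Euclidean division by [n.+1] recovers row and column. *)
Lemma entry_eq a b j j' : j <= n -> j' <= n ->
  (a * n.+1 + j == b * n.+1 + j') = (a == b) && (j == j').
Proof.
move=> hj hj'; apply/eqP/andP=> [h|[/eqP-> /eqP->] //].
by have := congr1 (edivn ^~ n.+1) h; rewrite !edivn_eq // => -[-> ->].
Qed.

Section Fill.
Variables (s : state R) (r : 'I_n) (w : 'I_(nk I) -> 'I_n).
Local Notation k := (nmem s aCNT 0).
Hypothesis simpleI : simple_graph I.
Hypothesis acyclicI : acyclic I.
Hypothesis rs : ready I s.
Hypothesis num : numbered r s.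
Hypothesis pos_gt0 : forall v, 0 < nmem s aPOS v.
Hypothesis pathw : forall i, is_path (@pth _ I i) r (w i).

(** Each commodity contributes all its possible gains to the row of its path's end, from which [c]
    selects one. *)
Lemma runs_fill_table : (forall j, xmem s 0 j = 0%R) ->
  runs (fare I) fill_table s (nk I * (n * 8 + 7) + 2)
    (fun s' => forall c, (forall u, 0 < u <= k -> c u < n) ->
       table_sum (tab s') c k = (\sum_i gain i (c (nmem s aPOS (w i))))%R).
Proof.
move=> x0; have kn : k <= n := numbering_size num.
have k1 : 0 < k by case: num => pr hk _ _ _; apply: leq_trans (hk r); rewrite pr.
eapply runs_time.
  apply: (@runs_for _ _ aX _ _ (k * 4 + n * 4 + 5) (nk I)
    (fun x s' => forall c, (forall u, 0 < u <= k -> c u < n) ->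
       table_sum (tab s') c k =
       (\sum_(i < nk I | (i < x)%N) gain i (c (nmem s aPOS (w i))))%R)) => //.
  - by rewrite /= (ready_nk rs).
  - move=> c _; rewrite big_lt0 /table_sum big1 // => u _.
    by rewrite /tab /= x0.
  - move=> x s1 hx hs1 ex1 hI; have rs1 := ready_same hs1 rs isT.
    pose i := Ordinal hx; pose u0 := nmem s aPOS (w i).
    have [p [hp hu hw hA]] := pathw i.
    have [lm1 lm2] := path_last_max simpleI acyclicI num pos_gt0 hp hu.
    rewrite hw -hA in lm1 lm2.
    have u0k : 0 < u0 <= k by rewrite pos_gt0; case: num => _ ->.
    eapply runs_time.
      run; run; run.
      set s1' := State _ _.
      have rs1' : ready I s1' by apply: ready_upd.
      apply: (@runs_for _ _ aY _ _ 2 k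
        (fun y s' => let E := nmem s' aEND 0 in
           [/\ E = 1 \/ 1 < E /\ (exists2 e : 'I_m, nmem s aPE E = e & e \in pth i),
               E <= maxn 1 y &
               forall t (e : 'I_m), 1 < t <= y -> e \in pth i -> nmem s aPE t = e -> t <= E])) => //.
      + by rewrite /= /upd /= (hs1.1 aCNT _ isT).
      + split; [by left | by [] |].
        by move=> t e; lia.
      + move=> y s2 hy hs2 ey2 [h1 h2 h3].
        have rs2 := ready_same hs2 rs1' isT.
        have ex2 : nmem s2 aX 0 = i by rewrite (hs2.1 aX _ isT).
        have epe t : nmem s2 aPE t = nmem s aPE t.
          by rewrite (hs2.1 aPE _ isT) /= /upd /= (hs1.1 aPE _ isT).
        have [y0|y0] := posnP y.
          apply: (@runs_cond _ _ _ _ _ _ 1 1); rewrite /= ey2 y0 //= => _.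
          run; rewrite /= /upd /=; split=> //; first by lia.
          by move=> t e; lia.
        have [|e he _] := @numbering_edge _ _ _ _ _ _ _ num y.+1; first by lia.
        eapply runs_time.
          run; rewrite /= ey2 ex2 y0 addn1 epe he ready_mat // lt0b => hb; run.
            rewrite /= /upd /= ey2 addn1; split.
            * by right; split; [lia | exists e].
            * by lia.
            * by move=> t e'; lia.
          rewrite /= /upd /=; split=> //; first by lia.
          move=> t e' ht he' hte; have [ety|nty] := eqVneq t y.+1.
            have ee : e' = e by apply: val_inj; rewrite /= -hte -he ety.
            by rewrite -ee he' in hb.
          by apply: (h3 t e') => //; lia.
        exact: leqnn.
      move=> s2 hs2 [h1 h2 h3].
      have rs2 := ready_same hs2 rs1' isT.
      have ex2 : nmem s2 aX 0 = i by rewrite (hs2.1 aX _ isT).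
      (* Both inequalities come from [path_last_max]: a stored number has its parent edge on the
         path, and the parent edge of [u0] has been scanned. *)
      have eE : nmem s2 aEND 0 = u0.
        apply/eqP; rewrite eqn_leq; apply/andP; split.
          case: h1 => [->|[h4 [e h5 h6]]]; first by case/andP: u0k.
          by apply: lm2 h6 h5; lia.
        have [h4|h4] := leqP u0 1; first by case: h1 => [->//|[]]; lia.
        have [e h5 h6] := lm1 h4; apply: h3 h6 h5.
        by rewrite h4; case/andP: u0k.
      have etab a j : tab s2 a j = tab s1 a j by rewrite /tab (hs2.2 0 _ isT).
      apply: (@runs_for _ _ aZ _ _ 2 n
        (fun z s' => forall a j, j <= n ->
           tab s' a j = (tab s1 a j + if (a == u0) && (j < z)%N then gain i j else 0)%R)) => //.
      + by rewrite /= (ready_nv rs2).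
      + by move=> a j hj; rewrite /tab /= -/(tab s2 a j) etab ltn0 andbF addr0.
      + move=> z s3 hz hs3 ez3 h; have rs3 := ready_same hs3 rs2 isT.
        have ex3 : nmem s3 aX 0 = i by rewrite (hs3.1 aX _ isT).
        have eE3 : nmem s3 aEND 0 = u0 by rewrite (hs3.1 aEND _ isT).
        eapply runs_time.
          run; rewrite /= ez3 ex3 ready_bnd // => hb; run => a j hj.
            rewrite /tab /= /upd /= ez3 ex3 eE3 (ready_wgt rs3) (ready_row rs3); last by lia.
            rewrite entry_eq //; last exact: ltnW.
            have [->|na] := eqVneq a u0; last by rewrite /= -/(tab s3 a j) h // (negbTE na).
            have [->|nj] := eqVneq j z.
              rewrite /= -/(tab s3 u0 z) h; last exact: ltnW.
              by rewrite eqxx ltnn ltnSn /= addr0 /gain hb.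
            rewrite /= -/(tab s3 u0 j) h // eqxx /= ltnS [in RHS]leq_eqVlt.
            by rewrite (negbTE nj).
          rewrite /tab /= -/(tab s3 a j) h //; congr (_ + _)%R.
          have [_|//] := eqVneq a u0; have [->|nj] := eqVneq j z.
            by rewrite ltnn ltnSn /= /gain (negbTE hb).
          by rewrite /= ltnS [in RHS]leq_eqVlt (negbTE nj).
        exact: leqnn.
      move=> s3 hs3 h c hc; rewrite (big_ltS _ _ i) /= -hI // -/u0.
      rewrite -(@sum_delta _ (fun u => gain i (c u)) k u0) // /table_sum -big_split /=.
      rewrite big_nat_cond [RHS]big_nat_cond; apply: eq_bigr => a ha.
      have hca : c a < n by apply: hc; lia.
      by rewrite [LHS](h a (c a) (ltnW hca)) hca andbT.
    by lia.
  by move=> s1 hs1 h c hc; rewrite h // big_lt_ord.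
by rewrite leq_add2r; apply: leq_mul => //; lia.
Qed.

End Fill.

End Table.

(** * The bottom-up and top-down passes *)

Section Sweeps.
Variables (R : realType) (I : fza R).
Local Notation n := (nv I).
Local Notation m := (ne I).
Local Notation tab := (tab I).
Implicit Types (s : state R) (r v : 'I_(nv I)) (e : 'I_(ne I)).

Section Sweep.
Variables (f : nat -> R) (s : state R) (k : nat) (par pe : nat -> nat).
Hypothesis rs : ready I s.
Hypothesis ek : nmem s aCNT 0 = k.
Hypothesis epar : forall t, nmem s aPAR t = par t.
Hypothesis epe : forall t, nmem s aPE t = pe t.
Hypothesis kn : k <= n.
Hypothesis k0 : 0 < k.
Hypothesis hpar : forall t, 1 < t <= k -> 0 < par t < t.

(** [table_sum_step] is iterated from number [k] down to 2. Greedy choices may be read off the final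
    table, because the row of an eliminated vertex no longer changes. *)
Lemma runs_sweep_up :
  runs f sweep_up s (n * (n * 4 + 5) + 2)
    (fun s' => forall c, admissible par k c ->
       (table_sum (tab s) c k <= table_sum (tab s') c 1)%R /\
       ((forall t, 1 < t <= k -> greedy par (tab s') c t) ->
        table_sum (tab s) c k = table_sum (tab s') c 1)).
Proof.
eapply runs_time.
  apply: (@runs_for _ f aX _ _ (n * 4 + 3) (k - 1)
    (fun x s' => forall c, admissible par k c ->
       (table_sum (tab s) c k <= table_sum (tab s') c (k - x))%R /\
       ((forall t, k - x < t <= k -> greedy par (tab s') c t) ->
        table_sum (tab s) c k = table_sum (tab s') c (k - x)))) => //.
  - by rewrite /= ek.
  - by move=> c _; rewrite subn0.
  - move=> x s1 hx hs1 ex1 hI; have rs1 := ready_same hs1 rs isT.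
    pose t := k - x; have ht : 1 < t <= k by rewrite /t; lia.
    pose p := par t; have hp : 0 < p < t := hpar ht.
    eapply runs_time.
      run; run; set s1' := State _ _.
      have rs1' : ready I s1' by apply: ready_upd.
      have et1 : nmem s1' aY 0 = t by rewrite /= /upd /= ex1 (hs1.1 aCNT _ isT) ek.
      apply: (@runs_for _ f aZ _ _ 2 n
        (fun z s' => forall a j, j <= n ->
           tab s' a j = (tab s1 a j + if (a == p) && (j < z)%N
             then Num.max (tab s1 t j) (tab s1 t j.+1) else 0)%R)) => //.
      + exact: (ready_nv rs1').
      + by move=> a j hj; rewrite ltn0 andbF addr0.
      + move=> z s2 hz hs2 ez h; have rs2 := ready_same hs2 rs1' isT.
        have et2 : nmem s2 aY 0 = t by rewrite (hs2.1 aY _ isT).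
        have ep2 : nmem s2 aPAR t = p.
          by rewrite (hs2.1 aPAR _ isT) /= /upd /= (hs1.1 aPAR _ isT) epar.
        (* The row read differs from the row written, so both candidates still have their values
           from before the loop. *)
        have tp : (t == p) = false by lia.
        have hz' := ltnW hz.
        have ett j : j <= n -> tab s2 t j = tab s1 t j.
          by move=> hj; rewrite h // tp addr0.
        have step s3 x1 : x1 = Num.max (tab s1 t z) (tab s1 t z.+1) ->
            (forall j, xmem s3 0 j =
               if j == p * n.+1 + z then (tab s2 p z + x1)%R else xmem s2 0 j) ->
            forall a j, j <= n ->
              tab s3 a j = (tab s1 a j + if (a == p) && (j < z.+1)%N
                then Num.max (tab s1 t j) (tab s1 t j.+1) else 0)%R.
          move=> ex1' hs3 a j hj; rewrite {1}/tab hs3 entry_eq //.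
          have [->|na] := eqVneq a p; last by rewrite /= -/(tab s2 a j) h // (negbTE na).
          have [->|nj] := eqVneq j z.
            rewrite /= h; last exact: ltnW.
            by rewrite eqxx ltnn ltnSn /= addr0 ex1'.
          by rewrite /= -/(tab s2 p j) h // eqxx /= ltnS [in RHS]leq_eqVlt (negbTE nj).
        have rt : nmem s2 aROW t = t * n.+1 by rewrite (ready_row rs2) //; lia.
        have rp : nmem s2 aROW p = p * n.+1 by rewrite (ready_row rs2) //; lia.
        eapply runs_time.
          run; rewrite /= et2 ez rt addn1 -/(tab s2 t z) -/(tab s2 t z.+1) !ett //;
            rewrite -?ltNge => hb; run.
            set s3 := State _ _; apply: (step s3 (tab s1 t z.+1)) => [|j]; first by rewrite (max_idPr hb).
            by rewrite /s3 /= /upd /= et2 ez ep2 rp rt addn1 -/(tab s2 t z.+1) ett.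
          set s3 := State _ _; apply: (step s3 (tab s1 t z)) => [|j]; first by rewrite (max_idPl (ltW hb)).
          by rewrite /s3 /= /upd /= et2 ez ep2 rp rt -/(tab s2 t z) ett.
        exact: leqnn.
      move=> s2 hs2 h c hc; have hlt := admissible_lt hpar hc.
      have [h1 h2] := hI c hc.
      have [|h3 h4] := @table_sum_step _ par (tab s1) (tab s2) c k t hpar ht hc.
        move=> u hu; have cu : c u < u by apply: hlt; lia.
        have cn : c u < n by lia.
        by rewrite (h u (c u) (ltnW cn)) cn andbT.
      have -> : k - x.+1 = t.-1 by rewrite /t; lia.
      split; first exact: le_trans h1 h3.
      (* Only row [p], which lies before [t], was modified; for numbers from [t] on, [greedy] means
         the same in both tables. *)
      move=> hg; have hg1 t' : t <= t' <= k -> greedy par (tab s1) c t'.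
        move=> ht'; have := hg t'; rewrite /greedy -[tab (set_scalar _ _ _)]/(tab s2).
        have hp' : 0 < par t' < t' by apply: hpar; lia.
        have cp : c (par t') < par t' by apply: hlt; lia.
        have tp : (t' == p) = false by lia.
        by rewrite !h ?tp ?addr0; [apply| |]; lia.
      rewrite h2 ?h4 //; first by apply: hg1; lia.
      by move=> t' ht'; apply: hg1; rewrite /t; lia.
    by lia.
  move=> s1 hs1 h c /h.
  by have -> : k - (k - 1) = 1 by lia.
rewrite leq_add2r; apply: leq_mul; lia.
Qed.

Hypothesis pe_inj : forall t t', 1 < t <= k -> 1 < t' <= k -> pe t = pe t' -> t = t'.

(** The count at [par t] is final when [t] is treated, since parents have smaller numbers. Array 6
    is written only for cut edges and otherwise keeps its zeros. *)
Lemma runs_sweep_down : nmem s aCUR 1 = 0 -> (forall j, nmem s 6 j = 0) ->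
  runs f sweep_down s (n * 7 + 2)
    (fun s' => let c := nmem s' aCUR in c 1 = 0 /\ forall t, 1 < t <= k ->
       greedy par (tab s) c t /\
       nmem s' 6 (pe t) = (tab s t (c (par t)) <= tab s t (c (par t)).+1)%R).
Proof.
move=> c10 out0.
eapply runs_time.
  apply: (@runs_for _ f aX _ _ 5 (k - 1)
    (fun x s' => let c := nmem s' aCUR in
     [/\ c 1 = 0, (forall t, x.+1 < t <= k -> nmem s' 6 (pe t) = 0) &
       forall t, 1 < t <= x.+1 -> greedy par (tab s) c t /\
       nmem s' 6 (pe t) = (tab s t (c (par t)) <= tab s t (c (par t)).+1)%R])) => //.
  - by rewrite /= ek.
  - by split=> [//|t _|t]; [exact: out0 | lia].
  - move=> x s1 hx hs1 ex1 [c1 o1 hI]; have rs1 := ready_same hs1 rs isT.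
    pose t := x.+2; have ht : 1 < t <= k by rewrite /t; lia.
    have hp := hpar ht.
    have ep : nmem s1 aPAR t = par t by rewrite (hs1.1 aPAR _ isT) epar.
    have epe1 : nmem s1 aPE t = pe t by rewrite (hs1.1 aPE _ isT) epe.
    have etab a j : xmem s1 0 (a * n.+1 + j) = tab s a j by rewrite (hs1.2 0 _ isT).
    have rt : nmem s1 aROW t = t * n.+1 by rewrite (ready_row rs1) //; lia.
    pose d := nmem s1 aCUR (par t).
    have step s2 : 
        (forall j, nmem s2 aCUR j = if j == t then d + (tab s t d <= tab s t d.+1)%R
                                    else nmem s1 aCUR j) ->
        (forall j, nmem s2 6 j = if (j == pe t) && (tab s t d <= tab s t d.+1)%R then 1
                                 else nmem s1 6 j) ->
        let c := nmem s2 aCUR in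
        [/\ c 1 = 0, (forall t', x.+2 < t' <= k -> nmem s2 6 (pe t') = 0) &
          forall t', 1 < t' <= x.+2 -> greedy par (tab s) c t' /\
           nmem s2 6 (pe t') = (tab s t' (c (par t')) <= tab s t' (c (par t')).+1)%R].
      (* Distinct numbers have distinct parent edges, so writing the bit of [t] spoils no other
         bit. *)
      move=> hc ho c; have ept t' : 1 < t' <= k -> (pe t' == pe t) = (t' == t).
        by move=> ht'; apply/eqP/eqP=> [/pe_inj->|->].
      split=> [|t' ht'|t' ht'].
      - by rewrite /c hc.
      - rewrite ho ept ?o1; [|lia|lia].
        by have -> : (t' == t) = false by rewrite /t; lia.
      have hp' : 0 < par t' < t' by apply: hpar; rewrite /t in ht; lia.
      have cp : c (par t') = nmem s1 aCUR (par t').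
        by rewrite /c hc ifN // /t; lia.
      rewrite /greedy cp /c hc ho ept; last by rewrite /t in ht; lia.
      have [->|nt] := eqVneq t' t.
        by split=> //=; case: (_ <= _)%R; rewrite ?o1 // /t; lia.
      by apply: hI; rewrite /t in nt; lia.
    eapply runs_time.
      do 5!run; rewrite /= /upd /= ex1 addn2 -/t ep rt !etab -/d addn1 => hb.
        do 3!run; apply: step => j; rewrite /= /upd /= ?ex1 ?addn2 -/t ?ep ?epe1 hb ?andbT ?addn1 //.
      run; apply: step => j; rewrite /= /upd /= ?ex1 ?addn2 -/t ?ep (negbTE hb) ?andbF ?addn0 ?andbT //.
    exact: leqnn.
  move=> s1 hs1 [h1 _ h3]; split=> // t ht; apply: h3; lia.
by rewrite leq_add2r; apply: leq_mul; lia.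
Qed.

End Sweep.

(** * Cut sets as count vectors *)

Section Optimality.
Variables (r : 'I_n) (k : nat) (pos : 'I_n -> nat) (par pe : nat -> nat).
Variable w : 'I_(nk I) -> 'I_n.
Hypothesis simpleI : simple_graph I.
Hypothesis acyclicI : acyclic I.
Hypothesis num : numbering r k pos par pe.
Hypothesis pos_gt0 : forall v, 0 < pos v.
Hypothesis pathw : forall i, is_path (@pth _ I i) r (w i).

Lemma revenue_count (F : {set 'I_m}) (c : nat -> nat) :
  c 1 = 0 ->
  (forall t e, 1 < t <= k -> pe t = e -> c t = c (par t) + (e \in F)) ->
  revenue F = (\sum_i gain i (c (pos (w i))))%R.
Proof.
move=> c1 hc; apply: eq_bigr => i _; rewrite /com_revenue /gain.
have [p [hp hu hw ->]] := pathw i.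
by rewrite (card_path_edges simpleI acyclicI num pos_gt0 c1 hc hp hu) hw.
Qed.

Lemma count_admissible (F : {set 'I_m}) (c : nat -> nat) :
  c 1 = 0 ->
  (forall t e, 1 < t <= k -> pe t = e -> c t = c (par t) + (e \in F)) ->
  admissible par k c.
Proof.
move=> c1 hc; split=> // t ht; have [e he _] := numbering_edge num ht.
by rewrite (hc t e ht he); case: (_ \in _); rewrite ?addn0 ?addn1; [right|left].
Qed.

Lemma exists_edge_count (F : {set 'I_m}) : exists2 c : nat -> nat, c 1 = 0 &
  forall t e, 1 < t <= k -> pe t = e -> c t = c (par t) + (e \in F).
Proof.
(* [insub] turns the stored number back into an edge; the default [false] occurs only for [t]
   outside the range from 2 to [k]. *)
pose g t : nat := if insub (pe t) is Some e then (e : 'I_m) \in F else false.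
have [|c c1 hc] := @exists_count k par g.
  by move=> t ht; have [_ _] := numbering_edge num ht.
by exists c => // t e ht he; rewrite hc // /g he valK.
Qed.

End Optimality.

End Sweeps.

(** * Composition of the phases and total running time *)

Definition rooted_fza_program : cmd :=
  CSeq init_rows (CSeq find_root (CSeq number_vertices
    (CSeq fill_table (CSeq sweep_up sweep_down)))).

Lemma runs_rooted_fza_program (R : realType) (I : fza R) :
  fza_wf I -> rooted I ->
  runs (fare I) rooted_fza_program (input I)
    (3 * nk I + 3 * nv I + 4 +
     (nv I * (nk I * (ne I * 5 + 8) + 7) + 2 +
     (nv I * (ne I * 8 + 4) + 4 +
     (nk I * (nv I * 8 + 7) + 2 +
     (nv I * (nv I * 4 + 5) + 2 + (nv I * 7 + 2))))))
    (fun s => optimal (output I s) /\ ne I <= nv I).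
Proof.
move=> [[nv0 simpleI hconn acyclicI] _ _ _] [r0 hr0].
apply: runs_bind (runs_init_rows I (fare I)) _ => s1 hs1 rs1.
apply: runs_bind (runs_find_root (fare I) rs1 _) _.
  by exists r0 => i; have [v hv] := hr0 i; apply: is_path_end_like hv.
move=> s2 hs2 [r er hr]; have rs2 := ready_same hs2 rs1 isT.
(* The vertex [r] found may differ from the given root [r0]; [end_like_is_path] shows that all paths
   start at [r] as well. *)
have [w pathw] : exists w : 'I_(nk I) -> 'I_(nv I), forall i, is_path (pth i) r (w i).
  apply: (@fin_all_exists _ _ (fun i v => is_path (pth i) r v)) => i.
  by have [v hv] := hr0 i; apply: end_like_is_path hv (hr i).
apply: runs_bind (runs_number_vertices (fare I) rs2 er _ hconn) _.
  by move=> j; rewrite (hs2.1 aPOS _ isT) (hs1.1 aPOS _ isT).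
move=> s3 hs3 [num pos_gt0]; have rs3 := ready_same hs3 rs2 isT.
set k := nmem s3 aCNT 0 in num; set par := nmem s3 aPAR in num.
set pe := nmem s3 aPE in num.
have kn : k <= nv I := numbering_size num.
have hpar t : 1 < t <= k -> 0 < par t < t.
  by move=> ht; have [] := numbering_edge num ht.
have k0 : 0 < k by case: num => pr hk _ _ _; apply: leq_trans (hk r); rewrite pr.
apply: runs_bind (runs_fill_table simpleI acyclicI rs3 num pos_gt0 pathw _) _.
  by move=> j; rewrite (hs3.2 0 _ isT) (hs2.2 0 _ isT) (hs1.2 0 _ isT).
move=> s4 hs4 htab; have rs4 := ready_same hs4 rs3 isT.
apply: runs_bind (@runs_sweep_up _ I (fare I) s4 k par rs4 _ _ kn k0 hpar) _.
- by rewrite (hs4.1 aCNT _ isT).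
- by move=> t; rewrite (hs4.1 aPAR _ isT).
move=> s5 hs5 hopt; have rs5 := ready_same hs5 rs4 isT.
apply: runs_weaken (leqnn _) _ (@runs_sweep_down _ I (fare I) s5 k par pe rs5 _ _ _ kn k0 hpar _ _ _).
- move=> s6 hs6 [c1 hc]; split; last exact: ne_le_nv num pos_gt0.
  set c := nmem s6 aCUR in c1 hc.
  (* Once only the root is left, all count vectors select the same entry. *)
  have table_sum1 c' : c' 1 = 0 -> table_sum (tab I s5) c' 1 = tab I s5 1 0.
    by move=> h; rewrite /table_sum big_nat1 h.
  have base (F : {set 'I_(ne I)}) c' : c' 1 = 0 ->
      (forall t (e : 'I_(ne I)), 1 < t <= k -> pe t = e -> c' t = c' (par t) + (e \in F)) ->
      admissible par k c' /\ revenue F = table_sum (tab I s4) c' k.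
    move=> h1 h2; have adm := count_admissible num h1 h2; split=> //.
    rewrite (revenue_count simpleI acyclicI num pos_gt0 pathw h1 h2) htab // => u hu.
    by apply: leq_trans (admissible_lt hpar adm hu) _; lia.
  (* The counts of the top-down pass are those of the output set: an edge is output exactly where
     the greedy choice adds one. *)
  have [||adm e1] := base (output I s6) c => //.
    move=> t e ht he; have [h1 h2] := hc t ht; rewrite h1 inE -he h2.
    by congr (_ + _); case: (_ <= _)%R.
  move=> F'; have [c' c1' hc'] := exists_edge_count num F'.
  have [adm' e1'] := base F' c' c1' hc'.
  rewrite e1 e1' ((hopt c adm).2 (fun t ht => (hc t ht).1)) table_sum1 //.
  by rewrite -(table_sum1 c') //; apply: (hopt c' adm').1.
- by rewrite (hs5.1 aCNT _ isT) (hs4.1 aCNT _ isT).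
- by move=> t; rewrite (hs5.1 aPAR _ isT) (hs4.1 aPAR _ isT).
- by move=> t; rewrite (hs5.1 aPE _ isT) (hs4.1 aPE _ isT).
- exact: numbering_edge_inj num.
- by rewrite (hs5.1 aCUR _ isT) (hs4.1 aCUR _ isT) (hs3.1 aCUR _ isT) (hs2.1 aCUR _ isT)
    (hs1.1 aCUR _ isT).
- by move=> j; rewrite (hs5.1 6 _ isT) (hs4.1 6 _ isT) (hs3.1 6 _ isT) (hs2.1 6 _ isT)
    (hs1.1 6 _ isT).
Qed.

Theorem theorem1 (R : realType) :
  exists (c : cmd) (C : nat), forall I : fza R, fza_wf I -> rooted I ->
    exists (t : nat) (s : state R),
      [/\ exec (fare I) c (input I) t s,
          optimal (output I s) &
          0 < nk I -> t <= C * (nv I ^ 2 * nk I)].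
Proof.
(* With |E| at most |V| and k positive, each monomial of the time bound is at most n^2 k. The
   coefficients add up to 85. *)
exists rooted_fza_program, 100 => I wf rt.
have [t [s [hexec ht [hopt hne]]]] := runs_rooted_fza_program wf rt.
exists t, s; split=> // hk; apply: leq_trans ht _.
have hn : 0 < nv I by case: wf => -[].
move: (nv I) (ne I) (nk I) hn hne hk => n m k hn hm hk.
have h1 : 0 < n * n * k by rewrite !muln_gt0 hn.
have h2 : n <= n * n * k by rewrite -mulnA leq_pmulr // muln_gt0 hn.
have h3 : k <= n * n * k by rewrite leq_pmull // muln_gt0 hn.
have h4 : n * n <= n * n * k by rewrite leq_pmulr.
have h5 : n * k <= n * n * k by rewrite -mulnA leq_pmull.
have h6 : n * m <= n * n * k by apply: leq_trans h4; rewrite leq_mul2l hm orbT.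
have h7 : n * (k * m) <= n * n * k by rewrite -mulnA leq_mul2l [n * k]mulnC leq_mul2l hm !orbT.
have -> : n ^ 2 = n * n by rewrite expnS expn1.
nia.
Qed.
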